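(* Let $0<\alpha<1$ and let $p_\alpha(x)=\frac{1-\alpha}{2\pi^{1-\alpha}}\cdot\frac{1}{|x|^\alpha}\cdot\mathbf{1}_{[-\pi,\pi]}(x)$. Let ${\bf V}$ be the $N\times N$ random Vandermonde matrix with phases i.i.d. with density $p_\alpha$, and let $\lambda_N$ be the maximum eigenvalue of ${\bf V}^*{\bf V}$. Then $$\mathbb{P}\Big(\lambda_N\ge\frac12\cdot\frac{N^\alpha}{2^{1-\alpha}}\Big)=1-o(1)\quad\text{as }N\to\infty.$$
   Context: ${\bf V}=N^{-1/2}(e^{-j(k-1)\theta_l})_{1\le k,l\le N}$ with $\theta_1,\dots,\theta_N$ i.i.d. with density $p_\alpha$. *)

(* Defs.v *)
From HB Require Import structures.
From mathcomp Require Import all_boot all_order all_algebra.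
From mathcomp Require Import complex.
From mathcomp Require Import all_classical all_reals all_analysis.
Set Implicit Arguments. Unset Strict Implicit. Unset Printing Implicit Defensive.
Import Order.TTheory GRing.Theory Num.Theory ComplexField.
Import numFieldNormedType.Exports.
Local Open Scope ring_scope.
Local Open Scope classical_set_scope.
Local Open Scope complex_scope.

Section Defs.
Variable R : realType.

(* density p_alpha(x) = (1-alpha)/(2 pi^(1-alpha)) * |x|^(-alpha) * 1_[-pi,pi](x);
   at x = 0 (a null set) powR gives 0 `^ (-alpha) = 0. *)
Definition p_alpha (alpha : R) (x : R) : R :=
  (1 - alpha) / (2 * (pi `^ (1 - alpha))) * (`|x| `^ (- alpha))
  * (\1_(`[- pi, pi]%classic) x).

Fixpoint iter_int (n : nat) (f : seq R -> \bar R) : \bar R :=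
  match n with
  | 0 => f [::]
  | n.+1 => (\int[(@lebesgue_measure R)]_x iter_int n (fun s => f (x :: s)))%E
  end.

Definition prob_iid (alpha : R) (N : nat) (E : seq R -> Prop) : \bar R :=
  iter_int N (fun s =>
    ((\prod_(l < N) p_alpha alpha (nth 0 s l)) * (\1_E s : R))%:E).

(* Random Vandermonde matrix V = N^{-1/2} (e^{-j (k-1) theta_l})_{k,l};
   row index k : 'I_N stands for k-1. *)
Definition vandermonde (N : nat) (theta : seq R) : 'M[R[i]]_N :=
  \matrix_(k, l)
    (((Num.sqrt (N%:R))^-1)%:C *
      (cos (k%:R * nth 0 theta l) -i* sin (k%:R * nth 0 theta l))).

Definition conjT (N : nat) (A : 'M[R[i]]_N) : 'M[R[i]]_N :=
  \matrix_(i, j) conjc (A j i).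

(* Largest eigenvalue of the Hermitian PSD matrix V^* V (its eigenvalues are
   real): supremum of the (finite) set of real eigenvalues. *)
Definition lambda_max (N : nat) (theta : seq R) : R :=
  sup [set a : R | eigenvalue (conjT (vandermonde N theta) *m vandermonde N theta) a%:C].

End Defs.

(* Main.v *)
(* Let S = {|x| <= pi/(2N)}, so that each phase falls in S with probability
   q = (2N)^(alpha-1), and M = N q = N^alpha / 2^(1-alpha).  Applying the Rayleigh
   quotient of V V^* (which has the same nonzero eigenvalues as V^* V) to the
   all-ones vector gives
     lambda_N >= sum_l |D_N(theta_l)|^2 / N^2,   D_N(x) = sum_(k < N) e^(jkx),
   and each term with theta_l in S is at least 2/3, since
   |D_N(x)|^2 = sum_(k, l) cos((k - l) x) >= N^2 (1 - N^2 x^2 / 12).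
   The number of phases in S is binomial (N, q), so by Chebyshev it exceeds 3M/4
   with probability at least 1 - 16/M, and 2/3 * 3/4 = 1/2. *)
Require Import Defs.
From HB Require Import structures.
From mathcomp Require Import all_boot all_order all_algebra.
From mathcomp Require Import complex ring lra measurable_realfun.
From mathcomp Require Import all_classical all_reals all_analysis.
Import Order.TTheory GRing.Theory Num.Theory.
Import numFieldNormedType.Exports.
Local Open Scope ring_scope.
Local Open Scope classical_set_scope.

(** * The Dirichlet kernel near zero *)

Lemma norm_sin_le {R : realType} (x : R) : `|sin x| <= `|x|.
Proof.
wlog x0 : x / 0 <= x => [H|].
  case: (leP 0 x) => [|/ltW] x0; first exact: H.
  by rewrite -normrN -sinN -(normrN x) H// oppr_ge0.
have csin : {within `[0, x], continuous sin}.
  by apply: continuous_subspaceT; exact: continuous_sin.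
have [c _] := MVT_segment x0 (fun y _ => is_derive_sin y) csin.
rewrite sin0 !subr0 => ->; rewrite normrM ler_piMl//; exact: cos_max.
Qed.

(** Half-angle formula cos x = 1 - 2 sin(x/2)^2, together with |sin y| <= |y|. *)
Lemma cos_ge_quadratic {R : realType} (x : R) : 1 - x ^+ 2 / 2 <= cos x.
Proof.
have -> : x = (x / 2) *+ 2 by rewrite -mulr_natr divfK.
set y := x / 2.
rewrite cos_mulr2n cos2sin2.
have : sin y ^+ 2 <= y ^+ 2.
  by rewrite -(real_normK (num_real (sin _))) -(real_normK (num_real y))
    ler_sqr ?nnegrE// norm_sin_le.
by rewrite -(mulr_natr y) -(mulr_natr (1 - _)); lra.
Qed.

Lemma sum_sqr_diff {R : realType} (n : nat) :
  \sum_(k < n) \sum_(l < n) (k%:R - l%:R) ^+ 2 =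
  (n%:R ^+ 2 * (n%:R ^+ 2 - 1)) / 6 :> R.
Proof.
have H1 (x : R) m : \sum_(l < m) (x - l%:R) ^+ 2 =
    m%:R * x ^+ 2 - x * m%:R * (m%:R - 1) + m%:R * (m%:R - 1) * (2 * m%:R - 1) / 6.
  elim: m => [|m IH]; first by rewrite big_ord0; field.
  by rewrite big_ord_recr/= IH -natr1; field.
under eq_bigr do rewrite H1.
(* The summand itself contains [n], so the induction runs on a separate upper limit [m], set to [n]
   at the end. *)
have H2 m : \sum_(k < m) (n%:R * k%:R ^+ 2 - k%:R * n%:R * (n%:R - 1)
      + n%:R * (n%:R - 1) * (2 * n%:R - 1) / 6) =
    n%:R * m%:R * (m%:R - 1) * (2 * m%:R - 1) / 6
    - n%:R * (n%:R - 1) * m%:R * (m%:R - 1) / 2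
    + m%:R * n%:R * (n%:R - 1) * (2 * n%:R - 1) / 6 :> R.
  elim: m => [|m IH]; first by rewrite big_ord0; field.
  by rewrite big_ord_recr/= IH -natr1; field.
by rewrite H2; field.
Qed.

(** Expanding both squares leaves the double sum of cos((k - l) x). The quadratic bound on cosine
    sums to n^2 - x^2 n^2 (n^2 - 1) / 12, and n^2 - 1 is then relaxed to n^2. *)
Lemma dirichlet_kernel_ge {R : realType} (n : nat) (x : R) :
  n%:R ^+ 2 * (1 - (n%:R * x) ^+ 2 / 12) <=
  (\sum_(k < n) cos (k%:R * x)) ^+ 2 + (\sum_(k < n) sin (k%:R * x)) ^+ 2.
Proof.
have -> : (\sum_(k < n) cos (k%:R * x)) ^+ 2 + (\sum_(k < n) sin (k%:R * x)) ^+ 2 =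
    \sum_(k < n) \sum_(l < n) cos ((k%:R - l%:R) * x).
  rewrite !expr2 !mulr_suml -big_split/=; apply: eq_bigr => k _.
  rewrite !mulr_sumr -big_split/=; apply: eq_bigr => l _.
  by rewrite mulrBl cosB.
apply: (@le_trans _ _ (\sum_(k < n) \sum_(l < n)
    (1 - x ^+ 2 / 2 * (k%:R - l%:R) ^+ 2))); last first.
  apply: ler_sum => k _; apply: ler_sum => l _.
  by apply: le_trans (cos_ge_quadratic _); rewrite exprMn mulrC mulrA.
under eq_bigr do rewrite sumrB -mulr_sumr.
rewrite sumrB -mulr_sumr sum_sqr_diff !sumr_const card_ord -mulrnA natrM.
have := sqr_ge0 (n%:R * x); rewrite exprMn.
set m : R := n%:R; lra.
Qed.

(** The angle bound gives |n x| <= pi/2 < 2, and 1 - 2^2 / 12 = 2/3. *)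
Lemma dirichlet_kernel_small_angle {R : realType} (n : nat) (x : R) :
  (0 < n)%N -> `|x| <= pi / (2 * n%:R) ->
  2 / 3 <= n%:R ^- 2 *
    ((\sum_(k < n) cos (k%:R * x)) ^+ 2 + (\sum_(k < n) sin (k%:R * x)) ^+ 2).
Proof.
move=> n0; have nR : 0 < n%:R :> R by rewrite ltr0n.
rewrite ler_pdivlMr ?mulr_gt0// => xn.
rewrite ler_pdivlMl ?exprn_gt0//; apply: le_trans (dirichlet_kernel_ge _ _).
rewrite ler_pM2l ?exprn_gt0//.
have : `|n%:R * x| <= 2.
  have := @pihalf_lt2 R; rewrite normrM ger0_norm ?ler0n//; lra.
rewrite -(real_normK (num_real (n%:R * x))).
rewrite -(ler_sqr (normr_ge0 _)) ?nnegrE//; lra.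
Qed.

(** * Rayleigh quotients and the largest eigenvalue *)

Section Rayleigh.
Local Open Scope sesquilinear_scope.

(** In unitary spectral coordinates [y] the quotient is an average of the eigenvalues with weights
    |y_i|^2, so they cannot all lie below [t]. *)
Lemma eigenvalue_ge_rayleigh {C : numClosedFieldType} (n : nat) (A : 'M[C]_n)
    (u : 'rV[C]_n) (t : C) :
  A \is hermsymmx -> t \is Num.real -> u != 0 ->
  t * (u *m u ^t*) 0 0 <= (u *m A *m u ^t*) 0 0 ->
  exists a, [/\ a \is Num.real, t <= a & eigenvalue A a].
Proof.
move=> Ah tr u0 tu.
set P := spectralmx A; set D := spectral_diag A.
have Pu : P \is unitarymx := spectral_unitarymx A.
have AE : A = invmx P *m diag_mx D *m P.
  exact/orthomx_spectralP/hermitian_normalmx.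
have Dr i : D 0 i \is Num.real.
  by have /mxOverP := hermitian_spectral_diag_real Ah; apply.
have PP : P ^t* *m P = 1%:M.
  by rewrite -invmx_unitary// mulVmx// unitarymx_unit.
pose y := u *m P ^t*.
have uE : u = y *m P by rewrite -mulmxA PP mulmx1.
have yE (B : 'M[C]_n) : y *m B *m y ^t* = u *m (P ^t* *m B *m P) *m u ^t*.
  by rewrite /y trmx_mul map_mxM trmxCK !mulmxA.
have [/existsP[i ti]|/existsPn H] := boolP [exists i, t <= D 0 i].
  exists (D 0 i); split=> //; apply/eigenvalueP; exists (row i P).
    have -> : row i P *m A = row i (diag_mx D *m P).
      rewrite -row_mul [in LHS]AE !mulmxA.
      by rewrite mulmxV ?unitarymx_unit// mul1mx.
    by rewrite row_mul row_diag_mx -scalemxAl -rowE.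
  apply/eqP => Pi0; have := congr1 (row i) (mulmxV (unitarymx_unit Pu)).
  rewrite row_mul Pi0 mul0mx => /rowP/(_ i)/eqP.
  by rewrite !mxE eqxx eq_sym oner_eq0.
have DP : P ^t* *m diag_mx D *m P = A by rewrite -invmx_unitary.
(* This is the hypothesis on [u] in spectral coordinates. If every eigenvalue is below [t], all
   terms are nonnegative, hence zero, which forces y = 0 and u = 0. *)
have tDy : \sum_i (t - D 0 i) * `|y 0 i| ^+ 2 <= 0.
  under eq_bigr do rewrite mulrBl.
  rewrite sumrB subr_le0 -mulr_sumr.
  have -> : \sum_i `|y 0 i| ^+ 2 = (u *m u ^t*) 0 0.
    have := yE 1%:M; rewrite !mulmx1 PP mulmx1 => <-.
    by rewrite mxE; apply: eq_bigr => j _; rewrite !mxE normCK.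
  apply: (le_trans tu); rewrite -DP -yE mxE le_eqVlt; apply/orP; left; apply/eqP.
  by apply: eq_bigr => j _; rewrite mul_mx_diag !mxE normCK mulrAC mulrC.
have tD i : D 0 i < t by rewrite real_ltNge// H.
have ge0 i : 0 <= (t - D 0 i) * `|y 0 i| ^+ 2.
  by rewrite mulr_ge0 ?exprn_ge0// subr_ge0 ltW.
have /eqP : \sum_i (t - D 0 i) * `|y 0 i| ^+ 2 = 0.
  by apply/eqP; rewrite eq_le tDy sumr_ge0.
rewrite psumr_eq0// => /allP y0.
case/eqP: u0; rewrite uE; suff -> : y = 0 by rewrite mul0mx.
apply/rowP => j; have /y0 := mem_index_enum j.
rewrite mulf_eq0 subr_eq0 gt_eqF//= expf_eq0/= normr_eq0 => /eqP ->.
by rewrite mxE.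
Qed.

(** Needed to place an eigenvalue below the [sup] in [lambda_max]. The characteristic polynomial
    splits over the complex numbers, and a real root is at most the sum of |Re z| over all roots
    z. *)
Lemma has_ubound_eigenvalue {R : realType} (n : nat) (A : 'M[R[i]]_n) :
  has_ubound [set a : R | eigenvalue A a%:C%C].
Proof.
have [r Ar] := closed_field_poly_normal (char_poly A).
exists (\sum_(z <- r) `|complex.Re z|) => a /=.
rewrite eigenvalue_root_char Ar (monicP (char_poly_monic A)) scale1r.
rewrite root_prod_XsubC => ra.
rewrite (perm_big _ (perm_to_rem ra)) big_cons /=.
by rewrite (le_trans (ler_norm a))// lerDl sumr_ge0.
Qed.

(** A row eigenvector [v] of the first product gives [v *m A] for the second, nonzero because [a]
    is. This serves to pass from V V^* to V^* V. *)
Lemma eigenvalue_mulmxC {F : fieldType} (n : nat) (A B : 'M[F]_n) (a : F) :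
  a != 0 -> eigenvalue (A *m B) a -> eigenvalue (B *m A) a.
Proof.
move=> a0 /eigenvalueP[v vAB v0]; apply/eigenvalueP; exists (v *m A).
  by rewrite mulmxA -(mulmxA v) vAB scalemxAl.
apply: contra v0 => /eqP vA; move: vAB.
by rewrite mulmxA vA mul0mx => /esym/eqP; rewrite scaler_eq0 (negbTE a0).
Qed.

Lemma conjTE {R : realType} (n : nat) (A : 'M[R[i]]_n) : conjT A = A ^t*.
Proof. by apply/matrixP => i j; rewrite !mxE. Qed.

Lemma sum_complexNi {R : realType} (n : nat) (a b : 'I_n -> R) :
  \sum_(k < n) (a k -i* b k)%C = ((\sum_(k < n) a k) -i* (\sum_(k < n) b k))%C.
Proof.
elim/big_rec3: _ => [|k x y z _ ->]; first by rewrite oppr0.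
by apply/eqP; rewrite eq_complex/= opprD !eqxx.
Qed.

Lemma lambda_max_ge {R : realType} (N : nat) (theta : seq R) (t : R) :
  (0 < N)%N -> 0 < t ->
  t <= \sum_(l < N) N%:R ^- 2 *
    ((\sum_(k < N) cos (k%:R * nth 0 theta l)) ^+ 2 +
     (\sum_(k < N) sin (k%:R * nth 0 theta l)) ^+ 2) ->
  t <= lambda_max N theta.
Proof.
move=> N0 t0 tle; have NR : 0 < N%:R :> R by rewrite ltr0n.
set V := vandermonde N theta.
(* Entry [l] of the all-ones row times V is N^(-1/2) times the conjugate of D_N(theta_l). *)
have VE l : `|(const_mx 1 *m V) 0 l : R[i]| ^+ 2 = (N%:R^-1 *
    ((\sum_(k < N) cos (k%:R * nth 0 theta l)) ^+ 2 +
     (\sum_(k < N) sin (k%:R * nth 0 theta l)) ^+ 2))%:C%C.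
  rewrite mxE; under eq_bigr do rewrite !mxE mul1r.
  rewrite -mulr_sumr sum_complexNi -add_Re2_Im2/=; congr (_%:C)%C.
  by rewrite !mul0r subr0 addr0 !exprMn exprVn sqr_sqrtr ?ler0n// sqrrN mulrDr.
have [||||a [/complex_realP[b ->] tb ab]] :=
  @eigenvalue_ge_rayleigh R[i] N (V *m V ^t*) (const_mx 1) t%:C%C.
- apply/is_hermitianmxP; rewrite expr0 scale1r.
  by rewrite trmx_mul map_mxM trmxCK.
- by apply/complex_realP; exists t.
- apply/rV0Pn; exists (Ordinal N0); rewrite mxE; exact: oner_neq0.
- have -> : const_mx 1 *m (V *m V ^t*) *m (const_mx 1) ^t* =
      (const_mx 1 *m V) *m (const_mx 1 *m V) ^t* :> 'M[R[i]]_1.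
    by rewrite trmx_mul map_mxM !mulmxA.
  rewrite !mxE.
  (* The all-ones vector has squared norm N, which accounts for the second factor 1/N. *)
  have -> : \sum_j (const_mx 1 : 'rV[R[i]]_N) 0 j *
      ((const_mx 1 : 'rV[R[i]]_N) ^t*) j 0 = N%:R.
    under eq_bigr do rewrite !mxE conjC1 mulr1.
    by rewrite sumr_const card_ord.
  under eq_bigr do rewrite [((_ *m V) ^t*) _ _]mxE [((_ *m V)^T) _ _]mxE -normCK VE.
  have -> : (N%:R : R[i]) = (N%:R : R)%:C%C by rewrite rmorph_nat.
  rewrite -rmorphM -rmorph_sum lecR -mulr_sumr.
  rewrite -mulr_sumr in tle; apply: (le_trans (ler_wpM2r (ltW NR) tle)).
  rewrite mulrAC ler_wpM2r ?expr2 ?invfM ?divfK ?gt_eqF//.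
  by apply: sumr_ge0 => l _; rewrite addr_ge0 ?sqr_ge0.
rewrite lecR in tb; apply: (le_trans tb).
apply: ub_le_sup; first exact: has_ubound_eigenvalue.
rewrite /= conjTE; apply: eigenvalue_mulmxC ab.
(* Since 0 < t <= b, the eigenvalue is nonzero and the two factors may be exchanged. *)
by rewrite eq_complex/= gt_eqF//; exact: lt_le_trans tb.
Qed.

End Rayleigh.

(** * Binomial expectations and Chebyshev's inequality *)

(* [binomE q n h] is the expectation of [h X] for [X] binomial [(n, q)]. *)
Fixpoint binomE {R : realType} (q : R) (n : nat) (h : nat -> R) : R :=
  if n is m.+1 then q * binomE q m (h \o succn) + (1 - q) * binomE q m h
  else h 0%N.

Lemma binomE_le {R : realType} (q : R) (n : nat) (g h : nat -> R) :
  0 <= q <= 1 -> (forall k, g k <= h k) -> binomE q n g <= binomE q n h.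
Proof.
move=> /andP[q0 q1]; elim: n g h => [|n IH] g h gh //=.
by apply: lerD; apply: ler_wpM2l; rewrite ?subr_ge0//; apply: IH => // k; exact: gh.
Qed.

Lemma binomE_cst {R : realType} (q : R) (n : nat) (c : R) :
  binomE q n (fun=> c) = c.
Proof. by elim: n => [|n IH]//=; rewrite /comp IH -mulrDl addrC subrK mul1r. Qed.

(** Variance plus squared bias. The centre [a] is arbitrary because a success in the first trial
    shifts it to a - 1. *)
Lemma binomE_sqr {R : realType} (q : R) (n : nat) (a b c : R) :
  binomE q n (fun k => b - c * (k%:R - a) ^+ 2) =
  b - c * (n%:R * q * (1 - q) + (n%:R * q - a) ^+ 2).
Proof.
elim: n a => [|n IH] a /=; first by ring.
rewrite IH (_ : _ \o succn = fun k => b - c * (k%:R - (a - 1)) ^+ 2).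
  by rewrite IH -natr1; ring.
by apply/funext => k /=; rewrite -natr1; ring.
Qed.

(** Chebyshev through a pointwise minorant: with M = n q, the indicator of k >= 3M/4 dominates 1 -
    16 (k - M)^2 / M^2, whose mean is 1 - 16 (1 - q) / M. *)
Lemma binomE_lower_tail {R : realType} (q : R) (n : nat) :
  0 < q <= 1 -> (0 < n)%N ->
  1 - 16 / (n%:R * q) <=
  binomE q n (fun k => (3 / 4 * (n%:R * q) <= k%:R)%R%:R).
Proof.
move=> /andP[q0 q1] n0; set M := n%:R * q.
have M0 : 0 < M by rewrite mulr_gt0// ltr0n.
have c0 : 0 <= 16 / M ^+ 2 by rewrite divr_ge0// exprn_ge0// ltW.
apply: (@le_trans _ _ (binomE q n (fun k => 1 - 16 / M ^+ 2 * (k%:R - M) ^+ 2))).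
  rewrite binomE_sqr subrr expr0n addr0 lerB//.
  rewrite (_ : 16 / M = 16 / M ^+ 2 * M); last by field; rewrite gt_eqF.
  by rewrite ler_wpM2l// ler_piMr ?gerBl ?(ltW M0) ?(ltW q0).
apply: binomE_le => [|k]; first by rewrite ltW.
case: (lerP (3 / 4 * M) k%:R) => kM /=.
  by rewrite mulr1n gerBl mulr_ge0// sqr_ge0.
(* For k < 3M/4 the deviation M - k exceeds M/4, so the minorant is nonpositive. *)
rewrite subr_le0 mulrAC ler_pdivlMr ?exprn_gt0//.
have -> : 1 * M ^+ 2 = 16 * (M / 4) ^+ 2 by field.
rewrite ler_pM2l// -(sqrrN (k%:R - M)) ler_sqr ?nnegrE; nra.
Qed.

(** * Iterated integrals and i.i.d. sampling *)

(* The nonnegative integral is a supremum over simple functions below the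
   integrand, hence monotone even on nonmeasurable functions: the event on
   [lambda_max] can be bounded without proving it measurable. *)
Lemma le_integral_nonneg d (T : measurableType d) (R : realType)
    (mu : {measure set T -> \bar R}) (f g : T -> \bar R) :
  (forall x, 0 <= f x)%E -> (forall x, f x <= g x)%E ->
  (\int[mu]_x f x <= \int[mu]_x g x)%E.
Proof.
move=> f0 fg; have g0 x : (0 <= g x)%E by exact: le_trans (f0 x) (fg x).
rewrite !ge0_integralTE//; apply: le_ereal_sup => _ [h hf <-].
by exists h => // x; exact: le_trans (hf x) (fg x).
Qed.

(** Monotonicity at one level requires nonnegative inner integrals, so both claims go through one
    induction. Only sequences of length [n] are ever evaluated, hence the size conditions. *)
Lemma iter_int_le {R : realType} (n : nat) (f g : seq R -> \bar R) :
  (forall s, size s = n -> 0 <= f s)%E ->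
  (forall s, size s = n -> f s <= g s)%E ->
  (0 <= iter_int n f)%E /\ (iter_int n f <= iter_int n g)%E.
Proof.
elim: n f g => [|n IH] f g f0 fg /=; first by split; [exact: f0|exact: fg].
have H x := IH (fun s => f (x :: s)) (fun s => g (x :: s))
  (fun s e => f0 (x :: s) (congr1 succn e)) (fun s e => fg (x :: s) (congr1 succn e)).
split; first by apply: integral_ge0 => x _; exact: (H x).1.
by apply: le_integral_nonneg => x; [exact: (H x).1|exact: (H x).2].
Qed.

(* The number of hits of [S] in an i.i.d. sample is binomial. *)
Lemma iter_int_count {R : realType} (p : R -> R) (S : pred R) (q : R)
    (n : nat) (h : nat -> R) (c : R) :
  (forall x, 0 <= p x) -> measurable_fun setT p -> measurable [set` S] ->
  (\int[lebesgue_measure]_x (p x * (S x)%:R)%:E = q%:E)%E ->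
  (\int[lebesgue_measure]_x (p x * (~~ S x)%:R)%:E = (1 - q)%:E)%E ->
  0 <= q <= 1 -> (forall k, 0 <= h k) -> 0 <= c ->
  iter_int n (fun s =>
    (c * \prod_(l < n) p (nth 0 s l) * h (count S s))%:E) = (c * binomE q n h)%:E.
Proof.
(* [c] is generalized to absorb the density factor of the outermost variable, and [h] to absorb its
   possible hit. *)
move=> p0 mp mS intS intSc q01; elim: n h c => [|n IH] h c h0 c0 /=.
  by rewrite big_ord0 mulr1.
have bge0 g : (forall k, 0 <= g k) -> 0 <= binomE q n g.
  by move=> g0; rewrite -(binomE_cst q n 0) binomE_le.
have mSR : measurable_fun setT (fun x => (S x)%:R : R).
  rewrite (_ : (fun x => _) = \1_[set` S]); first exact/measurable_indicP.
  by apply/funext => x; rewrite indicE mem_setE.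
have mSRc : measurable_fun setT (fun x => (~~ S x)%:R : R).
  rewrite (_ : (fun x => _) = fun x => 1 - (S x)%:R : R).
    by apply: measurable_funB => //; exact: measurable_cst.
  by apply/funext => x; case: (S x); rewrite /= ?subrr ?subr0.
under eq_integral => x _.
  rewrite (_ : iter_int n _ = iter_int n (fun s => (c * p x *
      \prod_(l < n) p (nth 0 s l) * h (S x + count S s)%N)%:E)); last first.
    by congr iter_int; apply/funext => s; rewrite big_ord_recl/= mulrA.
  rewrite (IH (fun k => h (S x + k)%N))//; last exact: mulr_ge0.
  (* Exactly one of the two indicators is 1, so the integrand splits along the recursion of
     [binomE]. *)
  rewrite (_ : _%:E = ((c * binomE q n (h \o succn))%:E * (p x * (S x)%:R)%:E
     + (c * binomE q n h)%:E * (p x * (~~ S x)%:R)%:E)%E); last first.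
    rewrite -!EFinM -EFinD; congr EFin; case: (S x) => /=.
      by rewrite !mulr1 !mulr0 addr0 mulrAC.
    by rewrite !mulr1 !mulr0 add0r mulrAC.
  over.
have mpS : measurable_fun setT (fun x => p x * (S x)%:R) by exact: measurable_funM.
have mpSc : measurable_fun setT (fun x => p x * (~~ S x)%:R) by exact: measurable_funM.
have b0 : 0 <= c * binomE q n h by rewrite mulr_ge0 ?bge0.
have b1 : 0 <= c * binomE q n (h \o succn).
  by rewrite mulr_ge0 ?bge0// => k; exact: h0.
rewrite ge0_integralD//=.
- rewrite !ge0_integralZl//=.
  + by rewrite intS intSc -!EFinM -EFinD; congr EFin; ring.
  + exact/measurable_EFinP.
  + by move=> x _; rewrite lee_fin mulr_ge0.
  + exact/measurable_EFinP.
  + by move=> x _; rewrite lee_fin mulr_ge0.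
- by move=> x _; rewrite -EFinM lee_fin !mulr_ge0// bge0// => k; exact: h0.
- by apply/measurable_EFinP; exact: measurable_funM.
- by move=> x _; rewrite -EFinM lee_fin !mulr_ge0// bge0.
- by apply/measurable_EFinP; exact: measurable_funM.
Qed.

(** * Mass of intervals around 0 under the density *)

Lemma p_alpha_ge0 {R : realType} (alpha x : R) : alpha < 1 -> 0 <= p_alpha alpha x.
Proof.
move=> a1; rewrite !mulr_ge0 ?powR_ge0 ?invr_ge0 ?mulr_ge0 ?powR_ge0 ?subr_ge0//.
exact: ltW.
Qed.

Lemma measurable_norm_powR {R : realType} (a : R) :
  measurable_fun setT (fun x : R => `|x| `^ a).
Proof. by apply: (measurableT_comp (measurable_powR _)); exact: normr_measurable. Qed.

Lemma measurable_p_alpha {R : realType} (alpha : R) :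
  measurable_fun setT (p_alpha alpha).
Proof.
apply: measurable_funM; last exact/measurable_indicP.
by apply: measurable_funM; [exact: measurable_cst|exact: measurable_norm_powR].
Qed.

Lemma measurable_norm_le {R : realType} (t : R) : measurable [set x : R | `|x| <= t].
Proof.
rewrite (_ : [set x | _] = `[- t, t]%classic); first exact: measurable_itv.
by apply/seteqP; split => x; rewrite /= in_itv/= ler_norml.
Qed.

(** Fundamental theorem of calculus with primitive x^(1 - alpha) / (1 - alpha), kept away from 0,
    where the integrand may blow up. *)
Lemma integral_powRN {R : realType} (alpha e t : R) : alpha < 1 -> 0 < e -> e < t ->
  (\int[lebesgue_measure]_(x in `[e, t]) (`|x| `^ (- alpha))%:E =
   ((t `^ (1 - alpha) - e `^ (1 - alpha)) / (1 - alpha))%:E)%E.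
Proof.
move=> a1 e0 et; have a10 : 1 - alpha != 0 by rewrite gt_eqF// subr_gt0.
have pos x : x \in `[e, t]%R -> 0 < x.
  by rewrite in_itv/= => /andP[ex _]; exact: lt_le_trans ex.
have dF (x : R) : 0 < x -> is_derive x 1 (fun y => (1 - alpha)^-1 * y `^ (1 - alpha))
    (x `^ (- alpha)).
  move=> x0; have -> : x `^ (- alpha) =
      (1 - alpha)^-1 *: ((1 - alpha) * x `^ (1 - alpha - 1)).
    by rewrite /GRing.scale/= mulrA mulVf// mul1r addrAC subrr add0r.
  by apply: is_deriveZ; exact: is_derive1_powR.
have cF (x : R) : 0 < x ->
    {for x, continuous (fun y => (1 - alpha)^-1 * y `^ (1 - alpha))}.
  move=> x0; apply/differentiable_continuous/derivable1_diffP.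
  by apply: ex_derive; exact: dF.
under eq_integral => x /set_mem/pos x0 do rewrite gtr0_norm//.
rewrite (@continuous_FTC2 _ _ (fun y => (1 - alpha)^-1 * y `^ (1 - alpha)))//.
- by rewrite -EFinB -mulrBr mulrC.
- apply: derivable_within_continuous => x /pos x0.
  by apply: derivable_powR; rewrite in_itv/= x0.
- split.
  + move=> x; rewrite in_itv/= => /andP[ex _].
    by apply: ex_derive; apply: dF; exact: lt_trans ex.
  + by apply: cvg_at_right_filter; exact: cF.
  + by apply: cvg_at_left_filter; apply: cF; exact: lt_trans et.
- move=> x; rewrite in_itv/= => /andP[ex _].
  by rewrite derive1E; apply: derive_val; apply: dF; exact: lt_trans ex.
Qed.

(** The substitution x -> -x turns the left interval into the right one. *)
Lemma integral_powRN_annulus {R : realType} (alpha e t : R) :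
  alpha < 1 -> 0 < e -> e < t ->
  (\int[lebesgue_measure]_(x in `[(- t)%R, (- e)%R] `|` `[e, t])
     (`|x| `^ (- alpha))%:E =
   (2 * ((t `^ (1 - alpha) - e `^ (1 - alpha)) / (1 - alpha)))%:E)%E.
Proof.
move=> a1 e0 et; rewrite ge0_integral_setU//=.
- rewrite integration_by_substitution_oppr ?ltW//.
    under eq_integral do rewrite /= normrN.
    by rewrite integral_powRN// -EFinD; congr (_%:E); ring.
  apply: (@continuous_in_subspaceT).
  move=> x; rewrite inE/= in_itv/= => /andP[_ xe].
  have x0 : x < 0 by rewrite (le_lt_trans xe)// oppr_lt0.
  apply: (@continuous_comp R R R (fun z : R => `|z|) (fun z : R => z `^ (- alpha))).
    exact: norm_continuous.
  apply/differentiable_continuous/derivable1_diffP.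
  by apply: derivable_powR; rewrite in_itv/= andbT normr_gt0 lt_eqF.
- by apply/measurable_EFinP/measurable_funTS; exact: measurable_norm_powR.
- apply/disj_setPS => x [/=]; rewrite !in_itv/= => /andP[_ xe] /andP[ex _].
  by move: (lt_le_trans e0 (le_trans ex xe)); rewrite oppr_gt0 ltNge (ltW e0).
Qed.

(** Monotone convergence over annuli whose inner radius shrinks to 0; they exhaust the interval
    minus the null set {0}. *)
Lemma integral_norm_powRN {R : realType} (alpha t : R) : alpha < 1 -> 0 < t ->
  (\int[lebesgue_measure]_(x in `[(- t)%R, t]) (`|x| `^ (- alpha))%:E =
   (2 * (t `^ (1 - alpha) / (1 - alpha)))%:E)%E.
Proof.
move=> a1 t0; set f := fun x : R => (`|x| `^ (- alpha))%:E.
have mf D : measurable_fun D f.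
  by apply/measurable_EFinP/measurable_funTS; exact: measurable_norm_powR.
(* [n.+2] keeps the inner radius strictly below [t] at n = 0 too. *)
pose e n : R := t * n.+2%:R^-1.
have e0 n : 0 < e n by rewrite mulr_gt0.
have et n : e n < t by rewrite gtr_pMr// invf_lt1// ltr1n.
pose F (n : nat) : set R := `[- t, - e n]%classic `|` `[e n, t]%classic.
have ecvg : e n @[n --> \oo] --> (0 : R).
  rewrite -(mulr0 t); apply: cvgMr.
  rewrite (_ : (fun n => _) = (fun n => @harmonic R n.+1)) //.
  by rewrite (cvg_shiftS (@harmonic R)); exact: cvg_harmonic.
have e_anti m n : (m <= n)%N -> e n <= e m.
  by move=> mn; rewrite ler_pM2l// lef_pV2 ?posrE// ler_nat.
have UF : \bigcup_n F n = `[- t, t]%classic `\ 0.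
  apply/seteqP; split => x /=.
    move=> [n _ [|]]; rewrite /= !in_itv/= => /andP[xt xe]; split.
    - by rewrite xt (le_trans xe)// (le_trans _ (ltW t0))// oppr_le0 ltW.
    - by apply/eqP; rewrite lt_eqF// (le_lt_trans xe)// oppr_lt0.
    - by rewrite xe andbT (le_trans _ xt)// (le_trans _ (ltW (e0 n)))// oppr_le0 ltW.
    - by apply/eqP; rewrite gt_eqF// (lt_le_trans _ xt).
  rewrite in_itv/= => -[/andP[tx xt] /eqP x0].
  have nx0 : 0 < `|x| by rewrite normr_gt0.
  have [n _ /(_ n (leqnn n)) en] : \forall n \near \oo, e n < `|x|.
    by apply: cvgr_lt ecvg _ nx0.
  exists n => //; case: (ltP x 0) => xs; [left|right]; rewrite /= in_itv/=.
    by rewrite tx lerNr -(ltr0_norm xs) ltW.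
  by rewrite xt andbT -(ger0_norm xs) ltW.
have ndF : nondecreasing_seq F.
  move=> m n mn; rewrite subsetEset => x [|]; rewrite /F/= !in_itv/= => /andP[h1 h2].
    by left; rewrite h1 (le_trans h2)// lerN2 e_anti.
  by right; rewrite h2 andbT (le_trans _ h1)// e_anti.
have mF n : measurable (F n) by exact: measurableU.
have := @ge0_nondecreasing_set_cvg_integral _ (measurableTypeR R) _ F f
  lebesgue_measure ndF mF (fun n => mf (F n)) (fun n x _ => powR_ge0 `|x| (- alpha)).
rewrite UF integral_setD1//; last exact: measurableD.
move=> /cvg_lim <-//; apply/cvg_lim => //.
under eq_fun do rewrite integral_powRN_annulus//.
apply: cvg_EFin; first exact: nearW.
rewrite -[in X in _ --> X](subr0 (t `^ _)).
apply: cvgMr; apply: cvgMl; apply: cvgB; first exact: cvg_cst.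
(* Since 1 - alpha > 0, the inner-radius term vanishes in the limit. *)
have /cvg_at_rightP := @powR_cvg0 R (1 - alpha) ltac:(by rewrite subr_gt0).
exact.
Qed.

(** As t <= pi, the window lies inside the support and only the normalising constant multiplies the
    integral of |x|^(-alpha). *)
Lemma integral_p_alpha {R : realType} (alpha t : R) :
  alpha < 1 -> 0 < t -> t <= pi ->
  (\int[lebesgue_measure]_x (p_alpha alpha x * (`|x| <= t)%R%:R)%:E =
   ((t / pi) `^ (1 - alpha))%:E)%E.
Proof.
move=> a1 t0 tpi; set c := (1 - alpha) / (2 * pi `^ (1 - alpha)).
have pip : 0 < pi `^ (1 - alpha) :> R by rewrite powR_gt0// pi_gt0.
transitivity (\int[lebesgue_measure]_(x in `[(- t)%R, t])
    (c%:E * (`|x| `^ (- alpha))%:E))%E.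
  rewrite [RHS]integral_mkcond; apply: eq_integral => x _.
  rewrite patchE mem_setE/= in_itv/= -ler_norml.
  case: ifPn => xt; last by rewrite mulr0.
  by rewrite mulr1 /p_alpha indicE mem_set ?mulr1//= in_itv/= -ler_norml (le_trans xt).
rewrite ge0_integralZl//=.
- rewrite integral_norm_powRN// -EFinM; congr EFin.
  rewrite powRM ?invr_ge0 ?pi_ge0 ?(ltW t0)// -(powR_inv1 (pi_ge0 R)) -powRrM mulN1r powRN.
  by rewrite /c; field; rewrite !gt_eqF ?subr_gt0.
- by apply/measurable_EFinP/measurable_funTS; exact: measurable_norm_powR.
- by rewrite lee_fin divr_ge0 ?mulr_ge0 ?subr_ge0 ?(ltW a1) ?(ltW pip).
Qed.

(** The window with t = pi carries the total mass 1; the complement follows by subtraction. *)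
Lemma integral_p_alphaC {R : realType} (alpha t : R) :
  alpha < 1 -> 0 < t -> t <= pi ->
  (\int[lebesgue_measure]_x (p_alpha alpha x * (~~ (`|x| <= t)%R)%:R)%:E =
   (1 - (t / pi) `^ (1 - alpha))%:E)%E.
Proof.
move=> a1 t0 tpi.
have mS (s : R) : measurable_fun setT (fun x : R => (`|x| <= s)%R%:R : R).
  rewrite (_ : (fun x => _) = \1_[set x : R | `|x| <= s]).
    by apply/measurable_indicP; exact: measurable_norm_le.
  by apply/funext => x; rewrite indicE mem_setE.
have := @integral_p_alpha R alpha pi a1 (pi_gt0 R) (lexx pi).
rewrite divff ?gt_eqF ?pi_gt0// powR1.
under eq_integral => x _.
  (* The density vanishes outside [-pi, pi], so the factor |x| <= pi can be traded for the split at
     [t]. *)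
  rewrite (_ : _%:E = (p_alpha alpha x * (`|x| <= t)%R%:R)%:E +
    (p_alpha alpha x * (~~ (`|x| <= t)%R)%:R)%:E)%E; last first.
    rewrite -EFinD -mulrDr; congr (_%:E); rewrite /p_alpha.
    case: (lerP `|x| pi) => xpi.
      by case: (`|x| <= t); rewrite /= ?addr0 ?add0r.
    by rewrite indicE memNset ?mulr0 ?mul0r//= in_itv/= -ler_norml leNgt xpi.
  over.
rewrite ge0_integralD//=.
- rewrite integral_p_alpha// EFinB => <-.
  by rewrite addeAC subee ?add0e.
- by move=> x _; rewrite lee_fin mulr_ge0// p_alpha_ge0.
- by apply/measurable_EFinP/measurable_funM; [exact: measurable_p_alpha|exact: mS].
- by move=> x _; rewrite lee_fin mulr_ge0// p_alpha_ge0.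
- apply/measurable_EFinP/measurable_funM; first exact: measurable_p_alpha.
  rewrite (_ : (fun x => _) = fun x => 1 - (`|x| <= t)%R%:R : R).
    by apply: measurable_funB => //; exact: mS.
  by apply/funext => x; case: (`|x| <= t); rewrite /= ?subrr ?subr0.
Qed.

(** * The probability bound and the limit *)

(** Each phase in the window contributes at least 2/3 to the Rayleigh sum, and the other terms are
    nonnegative. A positive count makes the bound positive, as [lambda_max_ge] requires. *)
Lemma lambda_max_ge_count {R : realType} (N : nat) (theta : seq R) :
  (0 < N)%N -> size theta = N ->
  (0 < count (fun x : R => `|x| <= pi / (2 * N%:R))%R theta)%N ->
  2 / 3 * (count (fun x : R => `|x| <= pi / (2 * N%:R))%R theta)%:R <=
  lambda_max N theta.
Proof.
move=> N0 sN c0; apply: lambda_max_ge => //.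
  by rewrite mulr_gt0// ?divr_gt0// ltr0n.
rewrite -sum1_count natr_sum mulr_sumr big_mkcond/=.
rewrite (big_nth 0) sN big_mkord; apply: ler_sum => l _.
case: ifPn => small; first by rewrite mulr1 dirichlet_kernel_small_angle.
by rewrite mulr_ge0 ?invr_ge0 ?exprn_ge0 ?addr_ge0 ?sqr_ge0.
Qed.

(** The event contains that of at least 3M/4 hits, because 2/3 * 3/4 = 1/2. The upper bound closes
    the later squeeze. *)
Lemma prob_iid_lambda_max {R : realType} (alpha : R) (N : nat) :
  alpha < 1 -> (0 < N)%N ->
  let M := N%:R `^ alpha / 2 `^ (1 - alpha) in
  ((1 - 16 / M)%:E <= prob_iid alpha N
     (fun theta => (1 / 2 * M <= lambda_max N theta)%R) <= 1)%E.
Proof.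
move=> a1 N0 /=; set M := _ `^ alpha / _.
have NR : 0 < N%:R :> R by rewrite ltr0n.
have p1 : 0 < pi :> R := pi_gt0 R.
pose t : R := pi / (2 * N%:R); pose q : R := (t / pi) `^ (1 - alpha).
have t0 : 0 < t by rewrite divr_gt0// mulr_gt0.
have tpiE : t / pi = (2 * N%:R)^-1 by rewrite /t mulrAC divff ?mul1r// gt_eqF.
have N2 : 1 <= 2 * N%:R :> R by rewrite -natrM ler1n muln_gt0.
have tpi : t <= pi by rewrite -(mul1r pi) -ler_pdivrMr// tpiE invf_le1// mulr_gt0.
have q0 : 0 < q by rewrite powR_gt0// tpiE invr_gt0 mulr_gt0.
have q1 : q <= 1.
  apply: (@le_trans _ _ (1 `^ (1 - alpha))); last by rewrite powR1.
  have Ni : (2 * N%:R)^-1 <= 1 :> R by rewrite invf_le1// mulr_gt0.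
  by rewrite /q tpiE ge0_ler_powR ?nnegrE ?subr_ge0 ?(ltW a1)// invr_ge0 mulr_ge0.
have NqM : N%:R * q = M.
  rewrite /q tpiE -powR_inv1 ?mulr_ge0// -powRrM mulN1r powRM// mulrCA mulrC.
  congr (_ * _); last by rewrite powRN.
  rewrite -{1}(powRr1 (ltW NR)) -powRD; last by rewrite (gt_eqF NR) implybT.
  by congr (_ `^ _); ring.
have M0 : 0 < M by rewrite -NqM mulr_gt0.
pose S : pred R := fun x => `|x| <= t.
have hit h c := @iter_int_count R (p_alpha alpha) S q N h c
  (fun x => p_alpha_ge0 alpha x a1) (measurable_p_alpha alpha) (measurable_norm_le t)
  (integral_p_alpha alpha t a1 t0 tpi) (integral_p_alphaC alpha t a1 t0 tpi).
have q01 : 0 <= q <= 1 by rewrite (ltW q0) q1.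
have prod0 s : 0 <= \prod_(l < N) p_alpha alpha (nth 0 s l).
  by apply: prodr_ge0 => l _; exact: p_alpha_ge0.
apply/andP; split.
  apply: (@le_trans _ _ (iter_int N (fun s => (1 *
    \prod_(l < N) p_alpha alpha (nth 0 s l) *
    (3 / 4 * M <= (count S s)%:R)%R%:R)%:E))).
    rewrite (hit (fun k => (3 / 4 * M <= k%:R)%R%:R))// mul1r lee_fin -NqM.
    by apply: binomE_lower_tail => //; rewrite q0.
  apply: (iter_int_le _ _ _ _ _).2 => s sN; first by rewrite lee_fin !mulr_ge0.
  rewrite lee_fin mul1r ler_wpM2l// indicE.
  case: (lerP (3 / 4 * M) _) => // cM; rewrite mem_set//=.
  (* Since M > 0, reaching 3M/4 forces at least one hit. *)
  have cS : (0 < count S s)%N.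
    by rewrite -(ltr0n R) (lt_le_trans _ cM)// mulr_gt0.
  by apply: le_trans (lambda_max_ge_count _ _ N0 sN cS); rewrite -/t -/S; lra.
(* [hit] at the constant function 1 computes the total mass of the product density. *)
have -> : 1%E = iter_int N (fun s => (1 *
    \prod_(l < N) p_alpha alpha (nth 0 s l) * 1)%:E).
  by rewrite (hit (fun=> 1))// binomE_cst mul1r.
apply: (iter_int_le _ _ _ _ _).2 => s sN; rewrite lee_fin ?mul1r ?mulr_ge0//.
by rewrite ler_wpM2l// indicE lern1 leq_b1.
Qed.

Theorem theorem8 (R : realType) (alpha : R) (h0 : 0 < alpha) (h1 : alpha < 1) :
  prob_iid alpha N
    (fun theta : seq R =>
       (1 / 2) * ((N%:R `^ alpha) / (2 `^ (1 - alpha))) <= lambda_max N theta)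
  @[N --> \oo] --> 1%E.
Proof.
(* The bounds are available for N >= 1, so the limit is taken along n + 1. *)
have bounds n := prob_iid_lambda_max alpha n.+1 h1 (ltn0Sn n).
set u := fun N : nat => prob_iid alpha N _.
suff : u n.+1 @[n --> \oo] --> 1%E by rewrite (cvg_shiftS u).
apply: (squeeze_cvge (nearW _ bounds)).
- apply: cvg_EFin; first exact: nearW.
  rewrite -[in X in _ --> X](subr0 1); apply: cvgB; first exact: cvg_cst.
  (* With N = n + 1, 16/M = 16 * 2^(1 - alpha) * (1/N)^alpha, which tends to 0 because alpha > 0. *)
  rewrite (_ : (fun n => _) = fun n => 16 * 2 `^ (1 - alpha) * harmonic n `^ alpha).
    rewrite -(mulr0 (16 * 2 `^ (1 - alpha))); apply: cvgMr.
    have /cvg_at_rightP := powR_cvg0 h0; apply; split => [n|]; first exact: harmonic_gt0.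
    exact: cvg_harmonic.
  apply/funext => n; rewrite /harmonic/= -(@powR_inv1 R n.+1%:R)// -powRrM mulN1r powRN invf_div.
  by rewrite mulrA.
- exact: cvg_cst.
Qed.
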